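(* Fix integers $n$ and $d$ such that there exist trees of order $n$ and diameter $d$. Among all trees $T$ of order $n$ and diameter $d$, the minimum of $\xi^d(T)-\xi^c(T)$ is attained by a caterpillar.
   Context: For a vertex $v$ of a tree $T$: $\deg(v)$ is its degree, $\varepsilon(v)=\max_{u} d(v,u)$ its eccentricity, $D(v)=\sum_u d(v,u)$ its total distance ($d$ the path distance). $\xi^c(T)=\sum_v \varepsilon(v)\deg(v)$ and $\xi^d(T)=\sum_v\varepsilon(v)D(v)$. The diameter is the maximum eccentricity. A caterpillar is a tree in which removing all leaves yields a path (possibly empty or a single vertex). *)

(* Defs.v *)
From mathcomp Require Import all_boot all_algebra.

Set Implicit Arguments.
Unset Strict Implicit.
Unset Printing Implicit Defensive.

Definition simple_graph (V : finType) (e : rel V) : Prop :=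
  symmetric e /\ irreflexive e.

Definition connected_graph (V : finType) (e : rel V) : Prop :=
  0 < #|V| /\ forall x y : V, connect e x y.

(* With [e] symmetric, an edge xy gives the length-2 [ucycle] [:: x; y], which
   is not a cycle in the sense of graph theory; hence the bound 2. *)
Definition acyclic_graph (V : finType) (e : rel V) : Prop :=
  forall c : seq V, ucycle e c -> size c <= 2.

Definition is_tree (V : finType) (e : rel V) : Prop :=
  [/\ simple_graph e, connected_graph e & acyclic_graph e].

Definition deg (V : finType) (e : rel V) (v : V) : nat :=
  #|[set w | e v w]|.

Definition has_path (V : finType) (e : rel V) (x y : V) (k : nat) : bool :=
  [exists p : k.-tuple V, [&& path e x p, last x p == y & uniq (x :: p)]].

(* The least [k] such that a path with [k] edges joins [x] to [y]. A path has
   fewer than [#|V|] edges; the value is [#|V|] if there is no path. *)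
Definition dist (V : finType) (e : rel V) (x y : V) : nat :=
  find (has_path e x y) (iota 0 #|V|).

Definition ecc (V : finType) (e : rel V) (v : V) : nat :=
  \max_(u : V) dist e v u.

Definition total_dist (V : finType) (e : rel V) (v : V) : nat :=
  \sum_(u : V) dist e v u.

Definition diameter (V : finType) (e : rel V) : nat :=
  \max_(v : V) ecc e v.

(* Eccentric connectivity index. *)
Definition xi_c (V : finType) (e : rel V) : nat :=
  \sum_(v : V) ecc e v * deg e v.

(* Eccentric distance sum. *)
Definition xi_d (V : finType) (e : rel V) : nat :=
  \sum_(v : V) ecc e v * total_dist e v.

Definition xi_diff (V : finType) (e : rel V) : int :=
  ((xi_d e)%:Z - (xi_c e)%:Z)%R.

Definition leaf (V : finType) (e : rel V) (v : V) : bool := deg e v == 1.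

(* The subgraph induced on [S] is a path graph: [S] can be listed without
   repetition so that adjacent vertices are exactly the consecutive ones. *)
Definition induces_path (V : finType) (e : rel V) (S : {set V}) : Prop :=
  exists s : seq V,
    [/\ uniq s, s =i S &
        {in S &, forall x y : V,
           e x y = (index y s == (index x s).+1) || (index x s == (index y s).+1)}].

Definition caterpillar (V : finType) (e : rel V) : Prop :=
  is_tree e /\ induces_path e [set v | ~~ leaf e v].

Definition is_tree_of (n d : nat) (V : finType) (e : rel V) : Prop :=
  [/\ is_tree e, #|V| = n & diameter e = d].

(* Main.v *)
Require Import Defs.
From mathcomp Require Import all_boot all_order all_algebra.
From mathcomp Require Import zify.
From Stdlib Require Import Classical.

(* Fix a diametral path v_0, ..., v_d of a tree T; a vertex x off it has a
   projection v_i and a height h. Collapse T to the caterpillar in which every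
   such x becomes a leaf attached to v_i. Since D(x) - deg(x) is the sum of the
   distances from x to the vertices at distance at least 2, the difference of
   the indices is the sum over ordered pairs (x, y) of ecc(x) times far(d(x, y)),
   where far k = k for k >= 2 and far 0 = far 1 = 0. Collapsing increases no
   eccentricity, and it increases far(d(x, y)) only when x and y are adjacent and
   both off the path, say x is the parent of y, so that y has height h >= 2. The
   two ordered pairs on {x, y} then cost 4 (1 + max(i, d - i)), which is repaid
   by the pair formed by y and its projection v_i: in T it contributes at least
   (h + 2 max(i, d - i)) h, and after collapsing it contributes nothing. *)

Set Implicit Arguments.
Unset Strict Implicit.
Unset Printing Implicit Defensive.

(** * Graph distance as the length of a shortest walk *)

Lemma has_pathP (V : finType) (e : rel V) (x y : V) (k : nat) :
  reflect (exists p : seq V,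
             [/\ path e x p, last x p = y, uniq (x :: p) & size p = k])
          (has_path e x y k).
Proof.
apply: (iffP existsP) => [[p /and3P[ep /eqP lp up]] | [p [ep lp up sp]]].
  by exists p; rewrite size_tuple.
by exists (tcast sp (in_tuple p)); rewrite val_tcast /= ep lp eqxx.
Qed.

(** Any walk shortens to a simple path of no greater length; that length is below [#|V|], so [find]
    meets it in its search range. *)
Lemma dist_le_size (V : finType) (e : rel V) (x : V) (p : seq V) :
  path e x p -> dist e x (last x p) <= size p.
Proof.
move=> ep; case/shortenP: ep => q eq uq qp.
have sq : size q < #|V|.
  by rewrite -[(size q).+1]/(size (x :: q)) -(card_uniqP uq) max_card.
apply: (@leq_trans (size q)).
  rewrite leqNgt; apply/negP => lt_q.
  have := before_find 0 lt_q; rewrite nth_iota // add0n => /has_pathP[].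
  by exists q.
by apply: uniq_leq_size => //; case/andP: uq.
Qed.

Lemma dist_path (V : finType) (e : rel V) (x y : V) :
  connect e x y ->
  exists p, [/\ path e x p, last x p = y & size p = dist e x y].
Proof.
case/connectP => p0 ep0 ->; case/shortenP: ep0 => q eq uq _.
set z := last x q.
have hq : has (has_path e x z) (iota 0 #|V|).
  apply/hasP; exists (size q); last by apply/has_pathP; exists q.
  rewrite mem_iota /= add0n -[(size q).+1]/(size (x :: q)).
  by rewrite -(card_uniqP uq) max_card.
have := nth_find 0 hq; rewrite nth_iota; last by rewrite has_find size_iota in hq.
by rewrite add0n => /has_pathP[p [ep lp _ sp]]; exists p.
Qed.

Lemma distxx (V : finType) (e : rel V) (x : V) : dist e x x = 0.
Proof. by apply/eqP; rewrite -leqn0; apply: (@dist_le_size _ e x [::]). Qed.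

Lemma dist_edge (V : finType) (e : rel V) (x y : V) : e x y -> dist e x y <= 1.
Proof. by move=> exy; apply: (@dist_le_size _ e x [:: y]); rewrite /= exy. Qed.

Section Connected.

Variables (V : finType) (e : rel V).
Hypothesis conn : forall x y : V, connect e x y.

Lemma dist_triangle (x y z : V) : dist e x z <= dist e x y + dist e y z.
Proof.
have [p [ep lp <-]] := dist_path (conn x y).
have [q [eq lq <-]] := dist_path (conn y z).
rewrite -size_cat -lq -lp -last_cat; apply: dist_le_size.
by rewrite cat_path ep lp.
Qed.

Lemma dist_eq0 (x y : V) : dist e x y = 0 -> x = y.
Proof. by have [[|z p] [_ /= lp <-]] := dist_path (conn x y). Qed.

Lemma dist_next (x y : V) (k : nat) :
  dist e x y = k.+1 -> exists2 z, e x z & dist e z y <= k.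
Proof.
have [[|z p] [/= ep lp sp]] := dist_path (conn x y); first by rewrite -sp.
rewrite -sp => -[<-]; case/andP: ep => exz ep; exists z => //.
by rewrite -lp; apply: dist_le_size.
Qed.

Lemma dist_eq1 (x y : V) : dist e x y = 1 -> e x y.
Proof.
by case/dist_next => z exz; rewrite leqn0 => /eqP /dist_eq0 <-.
Qed.

(** Source of all lower bounds on distances: a potential that drops by at most 1 along each edge. *)
Lemma lipschitz_dist (F : V -> nat) :
  (forall x y, e x y -> F x <= (F y).+1) ->
  forall x y, F x <= dist e x y + F y.
Proof.
move=> lipF x y; have [p [ep <- <-]] := dist_path (conn x y).
elim: p x ep => //= z p IHp x /andP[exz ep].
by have := IHp z ep; have := lipF _ _ exz; lia.
Qed.

End Connected.

(** * The difference of the indices as one sum over ordered pairs *)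

Definition far (k : nat) : nat := if k <= 1 then 0 else k.

Lemma leq_far (j k : nat) : j <= k -> far j <= far k.
Proof. by rewrite /far; case: ifP; case: ifP; lia. Qed.

Lemma far_eq0 (k : nat) : k <= 1 -> far k = 0.
Proof. by rewrite /far => ->. Qed.

Definition far_sum (V : finType) (e : rel V) : nat :=
  \sum_(x : V) \sum_(y : V) ecc e x * far (dist e x y).

Lemma xi_diffE (V : finType) (e : rel V) :
  irreflexive e -> (forall x y, connect e x y) ->
  xi_diff e = Posz (far_sum e).
Proof.
move=> irr conn; rewrite /xi_diff.
suff -> : xi_d e = far_sum e + xi_c e by lia.
rewrite /xi_d /far_sum /xi_c -big_split /=; apply: eq_bigr => x _.
rewrite -big_distrr /= -mulnDr; congr (_ * _).
(* The degree becomes a sum of edge indicators over all [y], so the identity can be checked term by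
   term, according to whether the distance is 0, 1 or larger. *)
rewrite /total_dist /deg -sum1_card [X in _ + X]big_mkcond -big_split /=.
apply: eq_bigr => y _; rewrite inE /far; have := @dist_edge _ e x y.
have := dist_eq1 conn (x := x) (y := y); have := dist_eq0 conn (x := x) (y := y).
case: (dist e x y) => [/(_ erefl) <- _ _ | [_ /(_ erefl) -> // | k _ _ leF]].
  by rewrite irr.
by case: ifP => [/leF|] //; rewrite addn0.
Qed.

(** * Two tools for acyclicity *)

(* A vertex of maximal rank on a cycle would have [par x] as both its neighbours. *)
Lemma acyclic_ranked (V : finType) (e : rel V) (par : V -> V) (rk : V -> nat) :
  symmetric e ->
  (forall x y, e x y -> [\/ y = par x | rk x < rk y]) ->
  acyclic_graph e.
Proof.
move=> sym edge c uc; rewrite leqNgt; apply/negP => sc.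
case: c uc sc => // x0 c0; set c := x0 :: c0 => uc sc.
have [x xc xmax] := @arg_maxnP V x0 (mem c) rk (mem_head _ _).
have [i c' rotE] := rot_to xc.
have: ucycle e (x :: c') by rewrite -rotE rot_ucycle.
have maxc' y : y \in c' -> rk y <= rk x.
  by move=> yc; apply: xmax; rewrite /= -(mem_rot i) rotE inE yc orbT.
have: 2 < size (x :: c') by rewrite -rotE size_rot.
have nbr y : y \in c' -> e x y -> y = par x.
  by move=> /maxc' yx /edge[] //; lia.
case: c' nbr {rotE maxc'} => [|y [|z s]] // nbr _ /andP[].
rewrite /cycle rcons_path => /andP[/= /andP[exy _]].
rewrite sym => exz /and3P[_ /negP ny _]; apply: ny.
rewrite (nbr y (mem_head _ _) exy) -(nbr (last z s) _ exz) ?mem_last //.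
by rewrite inE mem_last orbT.
Qed.

(** If [y] and [z] differed, a simple path joining them and avoiding [x] would close up through [x]
    into a cycle with at least 3 vertices. *)
Lemma acyclic_neighbors (V : finType) (e : rel V) (x y z : V) :
  simple_graph e -> acyclic_graph e -> e x y -> e x z ->
  connect [rel a b | [&& e a b, a != x & b != x]] y z -> y = z.
Proof.
move=> [sym irr] acyc exy exz /connectP[p0 ep0 zE].
have avoid q b : path [rel a b | [&& e a b, a != x & b != x]] b q -> x \notin q.
  elim: q b => //= a q IHq b /andP[/and3P[_ _ ax] /IHq xq].
  by rewrite inE negb_or eq_sym ax.
case/shortenP: ep0 zE => p ep up _ zE.
case: p ep up zE => // a p ep up zE; have xp := avoid _ _ ep.
have yx : x != y by apply: contraTneq exy => <-; rewrite irr.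
have /acyc// : ucycle e (x :: y :: a :: p).
apply/andP; split; last first.
  by rewrite cons_uniq up inE negb_or yx xp.
rewrite /cycle rcons_path; apply/andP; split; last first.
  by rewrite sym -[last _ _]/(last y (a :: p)) -zE.
apply/andP; split=> //.
by apply: sub_path ep => b c /= /and3P[].
Qed.

(** * Projection of a tree onto a geodesic spine *)

(** This is |i - j|: subtraction is truncated, so one of the summands vanishes. *)
Definition gap (i j : nat) : nat := (i - j) + (j - i).

(** This interface carries all that the later comparison takes from acyclicity: each edge either
    lies on the spine or joins a vertex to its parent. *)
Definition spine_coordinates (V : finType) (e : rel V) (d : nat) (v : nat -> V)
    (pos height : V -> nat) (par : V -> V) : Prop :=
  [/\ forall i, i <= d -> pos (v i) = i /\ height (v i) = 0,
      forall x, pos x <= d,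
      forall x, height x = 0 -> v (pos x) = x,
      forall x, 0 < height x ->
        pos (par x) = pos x /\ height x = (height (par x)).+1 &
      forall x y, e x y ->
        [\/ [/\ height x = 0, height y = 0 & gap (pos x) (pos y) = 1],
            0 < height x /\ y = par x | 0 < height y /\ x = par y]].

Section Projection.

Variables (V : finType) (e : rel V) (d : nat) (v : nat -> V).
Hypotheses (tree : is_tree e)
  (edge_v : forall i, i < d -> e (v i) (v i.+1))
  (dist_v : forall i j, i <= j <= d -> j - i <= dist e (v i) (v j)).

Let conn x y : connect e x y. Proof. by case: tree => _ [_ +] _; apply. Qed.
Let sym : symmetric e. Proof. by case: tree => -[]. Qed.
Let irr : irreflexive e. Proof. by case: tree => -[]. Qed.
Let acyc : acyclic_graph e. Proof. by case: tree. Qed.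

Definition spine : {set V} := [set v i | i : 'I_d.+1].

Lemma in_spine i : i <= d -> v i \in spine.
Proof. by move=> le_i; apply/imsetP; exists (Ordinal (le_i : i < d.+1)). Qed.

Definition nearest (x : V) : V := [arg min_(u < v 0 in spine) dist e x u].
Definition spine_height (x : V) : nat := dist e x (nearest x).

Lemma nearest_spine x : nearest x \in spine.
Proof. by rewrite /nearest; case: arg_minnP => //; apply: in_spine. Qed.

Lemma height_le x u : u \in spine -> spine_height x <= dist e x u.
Proof.
rewrite /spine_height /nearest; case: arg_minnP => [|y _ + ?]; last by apply.
exact: in_spine.
Qed.

Lemma height_spine x : (spine_height x == 0) = (x \in spine).
Proof.
apply/eqP/idP => [/(dist_eq0 conn) -> | xP]; first exact: nearest_spine.
by have := height_le x xP; rewrite distxx; lia.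
Qed.

Lemma height_edge x y : e x y -> spine_height x <= (spine_height y).+1.
Proof.
move=> exy; have := dist_triangle conn x y (nearest y).
have := height_le x (nearest_spine y); have := dist_edge exy.
by rewrite -/(spine_height y); lia.
Qed.

(** A neighbour closer to the spine; a spine vertex has none, and by default is its own parent. *)
Definition parent (x : V) : V :=
  odflt x [pick y | e x y & spine_height y < spine_height x].

Lemma parentP x :
  0 < spine_height x ->
  e x (parent x) /\ spine_height x = (spine_height (parent x)).+1.
Proof.
case hx: (spine_height x) => [//|k] _; rewrite /parent.
case: pickP => [y /andP[exy lt_y] | none] /=.
  by have := height_edge exy; split=> //; lia.
have [y exy le_y] := dist_next conn hx.
by have := none y; rewrite exy hx ltnS (leq_trans (height_le y (nearest_spine x))).
Qed.

Definition avoid (x : V) : rel V := [rel a b | [&& e a b, a != x & b != x]].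

Lemma avoid_csym x : connect_sym (avoid x).
Proof.
by apply: sym_connect_sym => a b; rewrite /avoid /= sym [(a != x) && _]andbC.
Qed.

Lemma spine_avoid x i :
  0 < spine_height x -> i <= d -> connect (avoid x) (v 0) (v i).
Proof.
move=> hx; have vx j : j <= d -> v j != x.
  move=> /in_spine; rewrite -height_spine => /eqP vj.
  by apply: contraTneq hx => <-; rewrite vj.
elim: i => [|i IHi] lt_i; first exact: connect0.
apply: connect_trans (IHi (ltnW lt_i)) (connect1 _).
by rewrite /avoid /= edge_v // !vx // ltnW.
Qed.

(** The chain of parents from [y] descends strictly, so it cannot meet [x], which is at least as
    high as its start; once on the spine, it continues to [v 0] away from [x], which is off the
    spine. *)
Lemma below_avoid x y :
  0 < spine_height x -> spine_height y <= spine_height x -> y != x ->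
  connect (avoid x) y (v 0).
Proof.
move=> hx; move hy: (spine_height y) => k; elim: k y hy => [|k IHk] y hy le_y yx.
  move/eqP: hy; rewrite height_spine => /imsetP[i _ ->].
  by rewrite avoid_csym; apply: spine_avoid => //; case: i.
have [|ey hpy] := @parentP y; first by rewrite hy.
have px : parent y != x by apply: contraTneq le_y => <-; lia.
apply: (@connect_trans _ _ (parent y)); last by apply: IHk => //; lia.
by apply: connect1; rewrite /avoid /= ey yx px.
Qed.

(* Two neighbours of [x] no higher than [x] would be joined through the spine
   without using [x], closing a cycle. *)
Lemma edge_parent x y :
  0 < spine_height x -> e x y -> spine_height y <= spine_height x ->
  y = parent x.
Proof.
move=> hx exy le_y; have [exp hp] := parentP hx.
have neq z : e x z -> z != x by apply: contraTneq => ->; rewrite irr.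
apply: (@acyclic_neighbors _ e x) => //.
apply: (@connect_trans _ _ (v 0)); first by apply: below_avoid => //; apply: neq.
by rewrite avoid_csym; apply: below_avoid; rewrite ?neq //; lia.
Qed.

Definition spine_index (x : V) : nat := odflt ord0 [pick i : 'I_d.+1 | v i == x].

(** By [dist_v], distinct indices give vertices at positive distance, so [v] is injective on the
    indices up to [d]. *)
Lemma spine_index_v i : i <= d -> spine_index (v i) = i.
Proof.
move=> le_i; rewrite /spine_index; case: pickP => [[j /= le_j] /eqP vij | none] /=.
  have := @dist_v i j; have := @dist_v j i.
  by rewrite vij distxx; move: le_j; rewrite ltnS => ->; rewrite le_i; lia.
by have := none (Ordinal (le_i : i < d.+1)); rewrite eqxx.
Qed.

(** The projection is read off at the end of the chain of parents rather than from [nearest], which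
    makes it constant along parent edges by construction. *)
Definition spine_pos (x : V) : nat := spine_index (iter (spine_height x) parent x).

Lemma projection_coordinates : exists pos height par,
  spine_coordinates e d v pos height par.
Proof.
exists spine_pos, spine_height, parent.
have hv i : i <= d -> spine_pos (v i) = i /\ spine_height (v i) = 0.
  move=> le_i; have /eqP h0 : spine_height (v i) == 0.
    by rewrite height_spine in_spine.
  by rewrite /spine_pos h0 /= spine_index_v.
have v_pos x : spine_height x = 0 -> v (spine_pos x) = x.
  move=> h0; have : x \in spine by rewrite -height_spine h0.
  by case/imsetP=> i _ ->; case: (hv i _) => [|-> //]; case: i.
split=> // [x | x hx | x y exy].
- by rewrite /spine_pos /spine_index; case: (odflt _ _).
- by have [_ hp] := parentP hx; rewrite /spine_pos hp iterSr.
have [hx | hx] := posnP (spine_height x); have [hy | hy] := posnP (spine_height y).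
(* For an edge between spine vertices, geodesicity bounds the index difference by 1 and
   irreflexivity excludes 0. *)
- apply: Or31; split=> //.
  have dxy : dist e (v (spine_pos x)) (v (spine_pos y)) <= 1.
    by apply: dist_edge; rewrite !v_pos.
  have pd z : spine_pos z <= d by rewrite /spine_pos /spine_index; case: (odflt _ _).
  have neq : spine_pos x != spine_pos y.
    by apply: contraTneq exy => pxy; rewrite -(v_pos _ hx) pxy (v_pos _ hy) irr.
  have dyx : dist e (v (spine_pos y)) (v (spine_pos x)) <= 1.
    by apply: dist_edge; rewrite !v_pos // sym.
  have := @dist_v (spine_pos x) (spine_pos y).
  have := @dist_v (spine_pos y) (spine_pos x).
  by have := pd x; have := pd y; rewrite /gap; lia.
- by apply: Or33; split=> //; apply: edge_parent => //; rewrite 1?sym // hx.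
- by apply: Or32; split=> //; apply: edge_parent => //; rewrite hy.
(* With both ends off the spine, [edge_parent] is applied at an end of maximal height. *)
have [le_xy | lt_yx] := leqP (spine_height x) (spine_height y).
  by apply: Or33; split=> //; apply: edge_parent => //; rewrite sym.
by apply: Or32; split=> //; apply: edge_parent => //; apply: ltnW.
Qed.

End Projection.

(** * Existence of a diametral path *)

Lemma dist_le_ecc (V : finType) (e : rel V) (x y : V) : dist e x y <= ecc e x.
Proof. exact: leq_bigmax. Qed.

Lemma ecc_le_diameter (V : finType) (e : rel V) (x : V) :
  ecc e x <= diameter e.
Proof. exact: leq_bigmax. Qed.

Lemma diametral_path (V : finType) (e : rel V) :
  connected_graph e ->
  exists v : nat -> V,
    (forall i, i < diameter e -> e (v i) (v i.+1)) /\
    (forall i j, i <= j <= diameter e -> j - i <= dist e (v i) (v j)).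
Proof.
move=> [V0 conn].
have [x diamE] := eq_bigmax (ecc e) V0; have [y eccE] := eq_bigmax (dist e x) V0.
have dxy : diameter e = dist e x y by rewrite /diameter diamE /ecc eccE.
have [p [ep lp sp]] := dist_path (conn x y).
exists (nth x (x :: p)); rewrite dxy -sp; split=> [i lt_i | i j /andP[le_ij le_j]].
  by move/(pathP x): ep; apply.
have vE k : k <= size p -> nth x (x :: p) k = last x (take k p).
  move=> le_k; rewrite (last_nth x) size_takel //.
  by rewrite -[x :: take k p]/(take k.+1 (x :: p)) nth_take.
have dist_take k : k <= size p -> dist e x (nth x (x :: p) k) <= k.
  move=> le_k; rewrite vE // -{2}(size_takel le_k); apply: dist_le_size.
  by move: ep; rewrite -{1}(cat_take_drop k p) cat_path => /andP[].
have dist_drop k : k <= size p -> dist e (nth x (x :: p) k) y <= size p - k.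
  move=> le_k; rewrite vE // -size_drop.
  rewrite -lp -[in last x p](cat_take_drop k p) last_cat; apply: dist_le_size.
  by move: ep; rewrite -{1}(cat_take_drop k p) cat_path => /andP[].
(* The initial piece has length at most [i] and the final one at most [size p - j]; the triangle
   inequality leaves at least [j - i] for the middle. *)
have := dist_take i (leq_trans le_ij le_j); have := dist_drop j le_j.
set a := nth _ _ i; set b := nth _ _ j => dby dxa.
have := dist_triangle conn x a y; have := dist_triangle conn a b y.
by rewrite -sp; lia.
Qed.

(** * Lower bounds on distances and eccentricities in the original tree *)

Section Coordinates.

Variables (V : finType) (e : rel V) (d : nat) (v : nat -> V).
Variables (pos height : V -> nat) (par : V -> V).
Hypotheses (conn : forall x y : V, connect e x y)
  (coord : spine_coordinates e d v pos height par).

(** The bound vanishes at [x = y] and changes by at most 1 along an edge at [x]. For equal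
    projections only the height difference is safe, since [x] and [y] may share a branch. *)
Lemma coordinates_dist (x y : V) :
  (if pos x == pos y then gap (height x) (height y)
   else height x + gap (pos x) (pos y) + height y) <= dist e x y.
Proof.
pose F x := if pos x == pos y then gap (height x) (height y)
            else height x + gap (pos x) (pos y) + height y.
suff lipF a b : e a b -> F a <= (F b).+1.
  have Fy : F y = 0 by rewrite /F eqxx /gap subnn.
  by have := lipschitz_dist conn lipF x y; rewrite Fy addn0.
case: coord => _ _ _ par_coord edge; rewrite /F /gap.
case/edge=> [[ha hb] | [ha ->] | [hb ->]].
- by rewrite /gap ha hb; do 2 case: eqP; lia.
- by have [-> ->] := par_coord _ ha; case: eqP; lia.
- by have [-> ->] := par_coord _ hb; case: eqP; lia.
Qed.

Lemma coordinates_ecc (x : V) :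
  height x + pos x <= ecc e x /\ height x + (d - pos x) <= ecc e x.
Proof.
have [coord_v pos_le _ _ _] := coord.
have := leq_trans (coordinates_dist x (v 0)) (dist_le_ecc e x (v 0)).
have := leq_trans (coordinates_dist x (v d)) (dist_le_ecc e x (v d)).
have [-> ->] := coord_v 0 (leq0n d); have [-> ->] := coord_v d (leqnn d).
by have := pos_le x; rewrite /gap; do 2 case: eqP; lia.
Qed.

End Coordinates.

(* Moves every vertex off the spine down to a leaf hanging from its projection. *)
Definition collapse (V : finType) (pos height : V -> nat) : rel V :=
  fun x y => (0 < height x) + gap (pos x) (pos y) + (0 < height y) == 1.

(** * The collapsed graph: distances, diameter, tree and caterpillar structure *)

Section Collapse.

Variables (V : finType) (d : nat) (v : nat -> V) (pos height : V -> nat).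
Hypotheses (coord_v : forall i, i <= d -> pos (v i) = i /\ height (v i) = 0)
  (pos_le : forall x, pos x <= d)
  (v_pos : forall x, height x = 0 -> v (pos x) = x)
  (pos_inner : forall x, 0 < height x -> 0 < pos x < d).

Let c : rel V := collapse pos height.

Lemma collapse_sym : symmetric c.
Proof. by move=> x y; rewrite /c /collapse /gap; lia. Qed.

Lemma collapse_irr : irreflexive c.
Proof. by move=> x; rewrite /c /collapse /gap; lia. Qed.

Lemma collapse_spine i j : i <= d -> j <= d -> c (v i) (v j) = (gap i j == 1).
Proof.
by move=> /coord_v[pi hi] /coord_v[pj hj]; rewrite /c /collapse pi hi pj hj addn0.
Qed.

Lemma collapse_project x : 0 < height x -> c x (v (pos x)).
Proof.
move=> hx; have [px hv] := coord_v (pos_le x).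
by rewrite /c /collapse px hv hx /gap subnn.
Qed.

Lemma collapse_connect x y : connect c x y.
Proof.
have csym : connect_sym c := sym_connect_sym collapse_sym.
suff to0 z : connect c (v 0) z.
  by apply: connect_trans (to0 y); rewrite csym.
have spine0 i : i <= d -> connect c (v 0) (v i).
  elim: i => [|i IHi] lt_i; first exact: connect0.
  apply: connect_trans (IHi (ltnW lt_i)) (connect1 _).
  by rewrite collapse_spine ?(ltnW lt_i) // /gap; lia.
apply: connect_trans (spine0 _ (pos_le z)) _.
have [/v_pos -> | hz] := posnP (height z); first exact: connect0.
by rewrite csym; apply/connect1/collapse_project.
Qed.

Lemma collapse_dist x y :
  dist c x y <= (0 < height x) + gap (pos x) (pos y) + (0 < height y).
Proof.
have spine_dist k i j : i <= d -> j <= d -> gap i j = k -> dist c (v i) (v j) <= k.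
  elim: k i => [|k IHk] i le_i le_j gij.
    by have -> : i = j; [move: gij; rewrite /gap; lia|rewrite distxx].
  (* The spine neighbour of [i] one step closer to [j]. *)
  pose i' := if i < j then i.+1 else i.-1.
  have le_i' : i' <= d by rewrite /i'; case: ifP; lia.
  have := IHk i' le_i' le_j.
  have := dist_triangle collapse_connect (v i) (v i') (v j).
  have : dist c (v i) (v i') <= 1.
    apply: dist_edge; rewrite collapse_spine //.
    by move: gij; rewrite /i' /gap; case: ifP; lia.
  by move: gij; rewrite /i' /gap; case: ifP; lia.
have foot z : dist c z (v (pos z)) <= (0 < height z)
           /\ dist c (v (pos z)) z <= (0 < height z).
  have [hz | hz] := posnP (height z); first by rewrite v_pos // distxx.
  by split; apply: dist_edge; [|rewrite collapse_sym]; exact: collapse_project.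
have [fx _] := foot x; have [_ fy] := foot y.
have := spine_dist _ _ _ (pos_le x) (pos_le y) erefl.
have := dist_triangle collapse_connect x (v (pos x)) y.
have := dist_triangle collapse_connect (v (pos x)) (v (pos y)) y.
by lia.
Qed.

(** A hanging vertex [y] projects strictly inside the spine, so its extra step reaches no farther
    than the end of the spine beyond it. *)
Lemma collapse_ecc x :
  ecc c x <= (0 < height x) + maxn (pos x) (d - pos x).
Proof.
apply/bigmax_leqP => y _; have := collapse_dist x y.
have := @pos_inner y; have := pos_le x; have := pos_le y; rewrite /gap.
by case: (posnP (height y)) => hy /=; lia.
Qed.

Lemma collapse_diameter : diameter c = d.
Proof.
apply/eqP; rewrite eqn_leq; apply/andP; split.
  apply/bigmax_leqP => x _; have := collapse_ecc x.
  by have := @pos_inner x; have := pos_le x; case: posnP => hx /=; lia.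
(* For the lower bound, [pos] changes by at most 1 along an edge and falls from [d] to 0 between the
   ends of the spine. *)
have lip x y : c x y -> pos x <= (pos y).+1 by rewrite /c /collapse /gap; lia.
have := lipschitz_dist collapse_connect lip (v d) (v 0).
have [-> _] := coord_v (leqnn d); have [-> _] := coord_v (leq0n d); rewrite addn0.
move/leq_trans; apply; apply: leq_trans (ecc_le_diameter c (v d)).
exact: dist_le_ecc.
Qed.

Lemma collapse_tree : is_tree c.
Proof.
split.
- by split; [apply: collapse_sym | apply: collapse_irr].
- by split; [apply/card_gt0P; exists (v 0) | apply: collapse_connect].
(* The graph is rooted at [v 0]: [toward0] is the step to the root and the rank below is the
   depth. *)
pose toward0 x := if 0 < height x then v (pos x) else v (pos x).-1.
apply: (@acyclic_ranked _ _ toward0 (fun x => pos x + (0 < height x))).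
  exact: collapse_sym.
move=> x y; rewrite /c /collapse /toward0.
have [hx | hx] := posnP (height x); have [hy | hy] := posnP (height y);
  rewrite /gap /= => cxy.
- have [lt | ge] := ltnP (pos x) (pos y); [right; lia | left].
  by rewrite -[LHS]v_pos //; congr v; lia.
- by right; lia.
- by left; rewrite -[LHS]v_pos //; congr v; lia.
- by lia.
Qed.

(** By [pos_inner] nothing hangs from the ends of the spine, while an inner spine vertex already has
    two neighbours on the spine. *)
Lemma collapse_leaf x :
  leaf c x = (0 < height x) || (0 < d) && ((pos x == 0) || (pos x == d)).
Proof.
have single u w : c u w -> (forall z, c u z -> height z = 0 /\ pos z = pos w) ->
    height w = 0 -> leaf c u.
  move=> cuw uniq_w hw; rewrite /leaf /deg; apply/eqP.
  rewrite (_ : [set z | c u z] = [set w]) ?cards1 //.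
  apply/setP=> z; rewrite !inE; apply/idP/eqP => [/uniq_w[hz pz] | -> //].
  by rewrite -(v_pos hz) pz v_pos.
have adj z : c x z -> [\/ [/\ height x = 0, height z = 0 & gap (pos x) (pos z) = 1],
    [/\ 0 < height x, height z = 0 & pos x = pos z] |
    [/\ height x = 0, 0 < height z & pos x = pos z]].
  rewrite /c /collapse /gap => cxz.
  have [hx | hx] := posnP (height x); have [hz | hz] := posnP (height z).
  - by apply: Or31; split=> //; move: cxz; rewrite hx hz; lia.
  - by apply: Or33; split=> //; move: cxz; rewrite hx hz; lia.
  - by apply: Or32; split=> //; move: cxz; rewrite hx hz; lia.
  - by move: cxz; rewrite hx hz; lia.
have [hx | hx] /= := posnP (height x); last first.
  have [pv hv] := coord_v (pos_le x).
  apply: (single _ _ (collapse_project hx)) => // z /adj[[]|[]|[]]; rewrite ?pv; lia.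
(* If [d = 0], then [pos_inner] leaves a single vertex; its degree is 0, so it is not a leaf. *)
have [d0 | d_gt0] /= := posnP d.
  rewrite /leaf /deg (_ : [set z | c x z] = set0) ?cards0 //.
  apply/setP=> z; rewrite !inE; apply/negP=> /adj.
  have := pos_le x; have := pos_le z; have := @pos_inner z; rewrite /gap.
  by move=> ? ? ? [[]|[]|[]]; lia.
have xv : x = v (pos x) by rewrite v_pos.
have [p0 | p_gt0] /= := posnP (pos x).
  have [pv hv] := coord_v d_gt0.
  apply: (single _ (v 1)) => //.
    by rewrite xv p0 collapse_spine.
  move=> z /adj; have := @pos_inner z; rewrite /gap pv.
  by move=> ? [[]|[]|[]]; lia.
have [pd | p_lt] := eqVneq (pos x) d.
  have [pv hv] := coord_v (leq_pred d).
  apply: (single _ (v d.-1)) => //.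
    by rewrite xv pd collapse_spine ?leq_pred // /gap; lia.
  move=> z /adj; have := @pos_inner z; have := pos_le z; rewrite /gap pv.
  by move=> ? ? [[]|[]|[]]; lia.
have lt_pd : pos x < d by have := pos_le x; lia.
apply/negbTE; rewrite /leaf /deg neq_ltn; apply/orP; right.
have le_p : (pos x).-1 <= d by lia.
apply/card_gt1P; exists (v (pos x).-1), (v (pos x).+1); split.
- by rewrite inE {1}xv collapse_spine // /gap; lia.
- by rewrite inE {1}xv collapse_spine // /gap; lia.
apply: contraTneq p_gt0 => vv.
have [p1 _] := coord_v le_p; have [p2 _] := coord_v lt_pd.
by move: p1; rewrite vv p2; lia.
Qed.

Lemma collapse_caterpillar : caterpillar c.
Proof.
split; first exact: collapse_tree.
(* The non-leaves are the spine without its two ends, or the whole one-vertex spine when [d = 0];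
   [lo] is 1 or 0 accordingly. *)
pose lo : nat := 0 < d; pose m := d.+1 - lo - lo.
pose s := [seq v i | i <- iota lo m].
have s_le i : i \in iota lo m -> i <= d by rewrite mem_iota /m /lo; lia.
have s_uniq : uniq s.
  rewrite map_inj_in_uniq ?iota_uniq // => i j.
  move=> /s_le/coord_v[pi _] /s_le/coord_v[pj _] vij.
  by rewrite -pi vij.
have mem_s x : x \in s -> [/\ height x = 0, lo <= pos x < lo + m & v (pos x) = x].
  case/mapP=> i is_i ->; have [pi hi] := coord_v (s_le _ is_i).
  by rewrite pi; split=> //; rewrite -mem_iota.
have nonleaf_s : s =i [set x | ~~ leaf c x].
  move=> x; rewrite inE collapse_leaf; apply/idP/idP => [/mem_s[-> + _] | nl].
    by rewrite /m /lo; have := pos_le x; lia.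
  have h0 : height x = 0 by lia.
  apply/mapP; exists (pos x); last by rewrite v_pos.
  by rewrite mem_iota; have := pos_le x; move: nl; rewrite /m /lo; lia.
have index_s x : x \in s -> index x s = pos x - lo.
  case/mem_s=> _ lt_x vx; have lt_m : pos x - lo < m by lia.
  have <- : nth x s (pos x - lo) = x.
    by rewrite (nth_map 0) ?size_iota // nth_iota // subnKC //; lia.
  rewrite index_uniq ?size_map ?size_iota //.
  by rewrite (nth_map 0) ?size_iota // nth_iota // subnKC ?vx //; lia.
exists s; split=> // x y; rewrite -!nonleaf_s => xs ys.
rewrite !index_s //; have [hx lx _] := mem_s x xs; have [hy ly _] := mem_s y ys.
by rewrite /c /collapse hx hy /gap; lia.
Qed.

End Collapse.

(** * Comparison of the two sums over pairs *)

Lemma sum_graph (V : finType) (P : pred V) (f : V -> V) (F : V -> nat) :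
  \sum_(x : V) \sum_(y : V) (if P x && (y == f x) then F x else 0)
    = \sum_(x | P x) F x.
Proof.
rewrite [RHS]big_mkcond; apply: eq_bigr => x _.
case: (P x) => /=; last by rewrite big1.
by rewrite -big_mkcond big_pred1_eq.
Qed.

Section Comparison.

Variables (V : finType) (e : rel V) (v : nat -> V).
Variables (pos height : V -> nat) (par : V -> V).
Hypotheses (tree : is_tree e)
  (coord : spine_coordinates e (diameter e) v pos height par).

Let d := diameter e.
Let c := collapse pos height.

Let conn x y : connect e x y. Proof. by case: tree => _ [_ +] _; apply. Qed.

(** A vertex hanging from one end of the spine would be farther than the diameter from the other
    end. *)
Lemma coordinates_inner x : 0 < height x -> 0 < pos x < diameter e.
Proof.
have [_ pos_le _ _ _] := coord.
have [] := coordinates_ecc conn coord x; have := ecc_le_diameter e x.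
by have := pos_le x; lia.
Qed.

(* Upper bound for the eccentricity in the collapsed tree, lower bound in [e]. *)
Let E (x : V) : nat := (0 < height x) + maxn (pos x) (d - pos x).

Let ecc_ge x : height x + maxn (pos x) (d - pos x) <= ecc e x.
Proof. by have [] := coordinates_ecc conn coord x; rewrite -/d; lia. Qed.

Lemma far_sum_collapse : far_sum c <= far_sum e.
Proof.
have [coord_v pos_le v_pos par_coord edge] := coord.
have c_dist x y :
    dist c x y <= (0 < height x) + gap (pos x) (pos y) + (0 < height y).
  exact: collapse_dist coord_v pos_le v_pos x y.
have c_ecc x : ecc c x <= E x.
  exact: collapse_ecc coord_v pos_le v_pos coordinates_inner x.
have E_le x : E x <= ecc e x.
  by have := ecc_ge x; rewrite /E; case: (posnP (height x)); lia.
pose deep := [pred x | 1 < height x].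
pose foot x := v (pos x).
pose on (f : V -> V) (F : V -> nat) x y := if deep x && (y == f x) then F x else 0.
have sum_on f F : \sum_x \sum_y on f F x y = \sum_(x | deep x) F x.
  exact: sum_graph.
have sum_on' f F : \sum_x \sum_y on f F y x = \sum_(x | deep x) F x.
  by rewrite exchange_big; apply: sum_on.
(* [gain] is supported on the pairs made of a vertex of height at least 2 and its
   projection, [loss] on those made of such a vertex and its parent. *)
pose gain x y :=
  on foot (fun z => (E z).*2 + 2) x y + on foot (fun z => (E z).*2 - 2) y x.
pose loss x y :=
  on par (fun z => (E z).*2) x y + on par (fun z => (E z).*2) y x.
have foot_coord x : pos (foot x) = pos x /\ height (foot x) = 0.
  by rewrite /foot; apply: coord_v.
have dist_ge := coordinates_dist conn coord.
(* Both charges total [4 * E x] for each deep [x]: (2E + 2) + (2E - 2) against 2E + 2E, where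
   [E x >= 1] keeps the subtraction exact. Hence a bound on each pair suffices. *)
suff pointwise x y :
    ecc c x * far (dist c x y) + gain x y <= ecc e x * far (dist e x y) + loss x y.
  have gain_loss : \sum_x \sum_y gain x y = \sum_x \sum_y loss x y.
    rewrite /gain /loss; under eq_bigr do rewrite big_split /=.
    rewrite big_split /= sum_on sum_on'.
    under [RHS]eq_bigr do rewrite big_split /=.
    rewrite [RHS]big_split /= sum_on sum_on' -!big_split /=.
    by apply: eq_bigr => x; rewrite /deep /E /= => hx; rewrite (ltnW hx); lia.
  rewrite -(leq_add2r (\sum_x \sum_y gain x y)) {2}gain_loss.
  rewrite /far_sum -!big_split /=; apply: leq_sum => x _.
  by rewrite -!big_split /=; apply: leq_sum => y _.
(* A deep vertex and its projection become adjacent. In [e] their distance is at least 2 and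
   [ecc e x] is at least [E x + 1], which gives 2E + 2. *)
have [/andP[hx /eqP yE] | not_foot_y] := boolP (deep x && (y == foot x)).
  have [py hy] := foot_coord x; rewrite -yE in py hy.
  have -> : far (dist c x y) = 0.
    by apply: far_eq0; have := c_dist x y; rewrite py hy /gap; lia.
  have -> : gain x y = (E x).*2 + 2.
    by rewrite /gain /on hx yE eqxx /= -yE hy addn0.
  rewrite muln0 add0n (leq_trans _ (leq_addr _ _)) //.
  have le_far : 2 <= far (dist e x y).
    apply: (@leq_trans (far 2)) => //; apply: leq_far.
    by move: hx (dist_ge x y); rewrite py hy eqxx /gap /=; lia.
  apply: leq_trans (leq_mul (leqnn _) le_far); have := ecc_ge x.
  by move: hx; rewrite /E /=; case: (posnP (height x)); lia.
(* In the reversed pair the first vertex is the projection, whose eccentricity is only known to be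
   at least [E y - 1]; this gives 2E - 2. *)
have [/andP[hy /eqP xE] | not_foot_x] := boolP (deep y && (x == foot y)).
  have [px hx] := foot_coord y; rewrite -xE in px hx.
  have -> : far (dist c x y) = 0.
    by apply: far_eq0; have := c_dist x y; rewrite px hx /gap; lia.
  have -> : gain x y = (E y).*2 - 2.
    by rewrite /gain /on hy xE eqxx /= -xE hx.
  rewrite muln0 add0n (leq_trans _ (leq_addr _ _)) //.
  have le_far : 2 <= far (dist e x y).
    apply: (@leq_trans (far 2)) => //; apply: leq_far.
    by move: hy (dist_ge x y); rewrite px hx eqxx /gap /=; lia.
  apply: leq_trans (leq_mul (leqnn _) le_far); have := ecc_ge x.
  by move: hy; rewrite /E px /=; case: (posnP (height y)); lia.
have -> : gain x y = 0.
  by rewrite /gain /on (negbTE not_foot_y) (negbTE not_foot_x).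
rewrite addn0.
(* An edge off the spine contributes 0 in [e], but its ends may come to distance 2. The higher end
   is deep, so [loss] covers the cost; both ends have the same [E]. *)
have [/and3P[exy hx hy] | not_edge] := boolP [&& e x y, 0 < height x & 0 < height y].
  apply: (@leq_trans (E x).*2).
    rewrite -muln2; apply: leq_mul => //.
    have pxy : pos x = pos y.
      by case/edge: exy => [[hx0] | [_ ->] | [_ ->]]; [lia | |];
        have [] := par_coord _ hx; have [] := par_coord _ hy; lia.
    apply: (@leq_trans (far 2)) => //; apply: leq_far.
    by have := c_dist x y; rewrite pxy hx hy /gap; lia.
  apply: leq_trans (leq_addl _ _); rewrite /loss /on.
  case/edge: exy => [[hx0] | [_ yE] | [_ xE]]; first by lia.
    have [px hpx] := par_coord _ hx; rewrite -yE in px hpx.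
    by rewrite yE eqxx /= [1 < height x](_ : _ = true) ?leq_addr //; lia.
  have [py hpy] := par_coord _ hy; rewrite -xE in py hpy.
  have -> : E x = E y by rewrite /E py hx hy.
  by rewrite xE eqxx /= [1 < height y](_ : _ = true) ?leq_addl //; lia.
(* For all remaining pairs neither factor increases. *)
apply: leq_trans (leq_addr _ _); apply: leq_mul.
  exact: leq_trans (c_ecc x) (E_le x).
have [-> | neq_xy] := eqVneq x y; first by rewrite distxx.
have cd := c_dist x y; have dd := dist_ge x y.
have [pxy | npxy] := eqVneq (pos x) (pos y); last first.
  apply: leq_far; apply: leq_trans cd (leq_trans _ dd).
  by rewrite (negbTE npxy); case: (posnP (height x)); case: (posnP (height y)); lia.
(* Distinct non-adjacent vertices hanging from the same spine vertex were at distance at least 2 and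
   end at distance at most 2. *)
have [/andP[hx hy] | low] := boolP ((0 < height x) && (0 < height y)).
  apply: leq_far; rewrite hx hy !andbT in not_edge.
  have := dist_eq1 conn (x := x) (y := y); have := dist_eq0 conn (x := x) (y := y).
  move: cd; rewrite pxy hx hy /gap.
  case: (dist e x y) => [|[|k]] cd; last by lia.
    by move=> /(_ erefl) xy; rewrite xy eqxx in neq_xy.
  by move=> _ /(_ erefl); rewrite (negbTE not_edge).
by rewrite far_eq0 //; move: cd low; rewrite pxy /gap; lia.
Qed.

End Comparison.

(** * Passage to a minimal tree *)

Lemma collapse_to_caterpillar (n d : nat) (V : finType) (e : rel V) :
  is_tree_of n d e ->
  exists c : rel V,
    [/\ is_tree_of n d c, caterpillar c & far_sum c <= far_sum e].
Proof.
case=> tree cardV diamE; have [_ conn _] := tree; rewrite -diamE.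
have [v [edge_v dist_v]] := diametral_path conn.
have [pos [height [par coord]]] := projection_coordinates tree edge_v dist_v.
have inner := coordinates_inner tree coord.
have [coord_v pos_le v_pos _ _] := coord.
exists (collapse pos height); split.
- split=> //; first exact: collapse_tree coord_v pos_le v_pos.
  exact: collapse_diameter coord_v pos_le v_pos inner.
- exact: collapse_caterpillar coord_v pos_le v_pos inner.
- exact: far_sum_collapse tree coord.
Qed.

Lemma tree_xi_diff (n d : nat) (V : finType) (e : rel V) :
  is_tree_of n d e -> xi_diff e = Posz (far_sum e).
Proof. by case=> [[[_ irr] [_ conn] _] _ _]; apply: xi_diffE. Qed.

(** Stated for arbitrary propositions, by excluded middle, since it is applied to a predicate that
    quantifies over all finite types. *)
Lemma least_nat (P : nat -> Prop) :
  (exists k, P k) -> exists2 k, P k & forall j, P j -> k <= j.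
Proof.
case=> k; elim/ltn_ind: k => k IHk Pk.
have [[j [lt_jk Pj]] | none] := classic (exists j, j < k /\ P j).
  exact: IHk Pj.
by exists k => // j Pj; rewrite leqNgt; apply/negP => lt_jk; apply: none; exists j.
Qed.

Theorem theorem3p1 (n d : nat)
    (hnd : exists (V : finType) (e : rel V), is_tree_of n d e) :
  exists (V0 : finType) (e0 : rel V0),
    [/\ is_tree_of n d e0,
        caterpillar e0 &
        forall (V : finType) (e : rel V),
          is_tree_of n d e -> (xi_diff e0 <= xi_diff e)%R].
Proof.
(* On trees the difference of the indices is the natural number [far_sum], so a minimal tree exists;
   its collapse has no larger value and is therefore minimal too. *)
pose value k := exists (V : finType) (e : rel V), is_tree_of n d e /\ far_sum e = k.
have [|k [V [e [tree_e valE]]] least] := @least_nat value.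
  by case: hnd => V [e tree_e]; exists (far_sum e), V, e.
have [c [tree_c cat_c le_ce]] := collapse_to_caterpillar tree_e.
exists V, c; split=> // W f tree_f.
rewrite (tree_xi_diff tree_c) (tree_xi_diff tree_f) lez_nat.
by apply: leq_trans le_ce _; rewrite valE; apply: least; exists W, f.
Qed.
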